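(* Let $k$ be a commutative ring with $1$, let $A(B)^C$ be a coalgebra-Galois extension over $k$, and let $(A,C)_\psi$ be its canonical entwining structure, with $\psi(c\otimes a)=a_\alpha\otimes c^\alpha$ (summation understood). Suppose there exist a normalised integral $\mathfrak z=\sum_ia_i\otimes c_i$ and a normalised integral map $\gamma:C\otimes C\to A$ in $(A,C)_\psi$, and a unit $\tau\in k$, such that (i) $\sum_ia_i\,(1_{A(0)})_\alpha\,\gamma(c_i^\alpha\otimes1_{A(1)})=\tau$, (ii) $\sum_ia_{i(0)}\,\gamma(a_{i(1)}\otimes c_i)=\tau$, where $\rho^A(a)=a_{(0)}\otimes a_{(1)}$ and $\tau$ on the right-hand sides means $\tau1_A$. Then $B\hookrightarrow A$ is a strongly separable extension.
   Context: Algebras are associative unital $k$-algebras, coalgebras coassociative counital $k$-coalgebras, $\otimes=\otimes_k$; $\mu_A$ is the product of $A$, $\Delta_C(c)=c_{(1)}\otimes c_{(2)}$ and $\varepsilon_C$ the coproduct and counit of $C$; the name of a module also denotes its identity map. Coalgebra-Galois extension. Let $C$ be a coalgebra, $A$ an algebra and a right $C$-comodule with coaction $\rho^A:A\to A\otimes C$, and let $B=\{b\in A\mid\rho^A(ba)=b\rho^A(a)\text{ for all }a\in A\}$, a subalgebra of $A$. $B\hookrightarrow A$ is a coalgebra-Galois extension, denoted $A(B)^C$, if the map $\mathrm{can}:A\otimes_BA\to A\otimes C$, $a\otimes a'\mapsto a\rho^A(a')$, is bijective. The associated canonical entwining structure is $(A,C)_\psi$ with $\psi:C\otimes A\to A\otimes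 C$, $\psi(c\otimes a)=\mathrm{can}(\mathrm{can}^{-1}(1_A\otimes c)a)$. An integral in $(A,C)_\psi$ is an element $\mathfrak z=\sum_ia_i\otimes c_i\in A\otimes C$ such that $\sum_iaa_i\otimes c_i=\sum_ia_i\psi(c_i\otimes a)$ for all $a\in A$. It is normalised if $\sum_ia_i\varepsilon_C(c_i)=1$. An integral map in $(A,C)_\psi$ is a $k$-linear map $\gamma:C\otimes C\to A$ such that $(\gamma\otimes C)\circ(C\otimes\Delta_C)=\psi\circ(C\otimes\gamma)\circ(\Delta_C\otimes C)$ and $\mu_A\circ(\gamma\otimes A)=\mu_A\circ(A\otimes\gamma)\circ(\psi\otimes C)\circ(C\otimes\psi)$. It is normalised if $\gamma(c_{(1)}\otimes c_{(2)})=\varepsilon_C(c)1_A$ for all $c\in C$. Extensions of algebras $B\hookrightarrow A$. A separability idempotent is $u\in A\otimes_BA$ with $au=ua$ for all $a\in A$ and $\mu_{A,B}(u)=1_A$, where $\mu_{A,B}:A\otimes_BA\to A$ is induced by the product; the extension is separable if one exists. A conditional expectation is a unital $(B,B)$-bimodule map $E:A\to B$; the extension is split if one exists. The extension is strongly separable if it is separable and split and there exist a separability idempotent $u=\sum_iu_i\otimes u^i$, a conditional expectation $E:A\to B$ and a unit $\tau\in k$ such that for all $a\in A$: $\sum_iE(au_i)u^i=a\tau$ and $\sum_iu_iE(u^ia)=a\tau$. *)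

(* Defs.v *)
From HB Require Import structures.
From mathcomp Require Import all_boot all_algebra generic_quotient.
From mathcomp Require Import boolp classical_sets.

Set Implicit Arguments.
Unset Strict Implicit.
Unset Printing Implicit Defensive.

Import GRing.Theory.

Local Open Scope ring_scope.
Local Open Scope quotient_scope.

Reserved Notation "\tsum_ ( a , b <- t ) E"
  (at level 41, E at level 41, a name, b name,
   format "'[' \tsum_ ( a ,  b  <-  t ) '/  '  E ']'").

Section TensorProduct.
Variables (S : Type) (M N : zmodType).
Variables (actr : M -> S -> M) (actl : S -> N -> N).

(* The presentation of the tensor product: a list stands for the sum of the
   elementary tensors of its entries.  The quotient of the free commutative
   monoid by this congruence already has opposites, -(m, n) being (-m, n). *)
Inductive tens_rel : seq (M * N) -> seq (M * N) -> Prop :=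
| Tens_refl s : tens_rel s s
| Tens_sym s t : tens_rel s t -> tens_rel t s
| Tens_trans s t u : tens_rel s t -> tens_rel t u -> tens_rel s u
| Tens_cat s s' t t' :
    tens_rel s s' -> tens_rel t t' -> tens_rel (s ++ t) (s' ++ t')
| Tens_swap s t : tens_rel (s ++ t) (t ++ s)
| Tens_0l n : tens_rel [:: (0, n)] [::]
| Tens_addl m m' n : tens_rel [:: (m + m', n)] [:: (m, n); (m', n)]
| Tens_addr m n n' : tens_rel [:: (m, n + n')] [:: (m, n); (m, n')]
| Tens_act m x n : tens_rel [:: (actr m x, n)] [:: (m, actl x n)].

Definition tens_relb (s t : seq (M * N)) : bool := `[< tens_rel s t >].

Lemma tens_relb_refl : reflexive tens_relb.
Proof. by move=> s; apply/asboolP/Tens_refl. Qed.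

Lemma tens_relb_sym : symmetric tens_relb.
Proof.
by move=> s t; apply/asboolP/asboolP; exact: Tens_sym.
Qed.

Lemma tens_relb_trans : transitive tens_relb.
Proof.
move=> t s u /asboolP st /asboolP tu; apply/asboolP; exact: Tens_trans st tu.
Qed.

Canonical tens_equiv :=
  EquivRel tens_relb tens_relb_refl tens_relb_sym tens_relb_trans.

Definition tens := {eq_quot tens_equiv}.

HB.instance Definition _ := Choice.on tens.
HB.instance Definition _ := EqQuotient.on tens.

Definition tens_of (s : seq (M * N)) : tens := \pi_tens s.

Lemma tens_ofP s t : tens_rel s t <-> tens_of s = tens_of t.
Proof.
split=> [st|/eqmodP/asboolP//].
by apply/eqmodP/asboolP.
Qed.

Lemma tens_reprK (t : tens) : tens_of (repr t) = t.
Proof. exact: reprK. Qed.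

Lemma tens_repr_of s : tens_rel (repr (tens_of s)) s.
Proof. by apply/tens_ofP; rewrite tens_reprK. Qed.

Definition tens_opps (s : seq (M * N)) := [seq (- p.1, p.2) | p <- s].

Definition tens_add (t u : tens) : tens := tens_of (repr t ++ repr u).
Definition tens_opp (t : tens) : tens := tens_of (tens_opps (repr t)).
Definition tens_zero : tens := tens_of [::].

Lemma tens_ofD s t : tens_of (s ++ t) = tens_add (tens_of s) (tens_of t).
Proof. by apply/tens_ofP/Tens_cat; apply/Tens_sym/tens_repr_of. Qed.

Fact tens_addC : commutative tens_add.
Proof. by move=> t u; apply/tens_ofP/Tens_swap. Qed.

Fact tens_addA : associative tens_add.
Proof.
move=> t u v; rewrite -[t]tens_reprK -[u]tens_reprK -[v]tens_reprK.
by rewrite -!tens_ofD catA.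
Qed.

Fact tens_add0 : left_id tens_zero tens_add.
Proof. by move=> t; rewrite -[t]tens_reprK -tens_ofD. Qed.

Fact tens_addN : left_inverse tens_zero tens_opp tens_add.
Proof.
move=> t; rewrite -[X in tens_add _ X]tens_reprK -tens_ofD.
elim: (repr t) => [|[m n] s IHs]; first by [].
rewrite /tens_opps map_cons -/(tens_opps s) /=.
have tens_addCA (u v w : tens) :
  tens_add u (tens_add v w) = tens_add v (tens_add u w).
  by rewrite !tens_addA (tens_addC u).
rewrite -cat1s -[(m, n) :: s]cat1s !tens_ofD.
rewrite [tens_add (tens_of (tens_opps s)) _]tens_addCA -[X in _ = X]IHs tens_ofD.
rewrite tens_addA -[RHS]tens_add0; congr (tens_add _ _).
rewrite -tens_ofD; apply/tens_ofP.
apply: Tens_trans (Tens_0l n); rewrite -(addNr m).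
exact/Tens_sym/Tens_addl.
Qed.

HB.instance Definition _ :=
  GRing.isZmodule.Build tens tens_addA tens_addC tens_add0 tens_addN.

Definition tpure (m : M) (n : N) : tens := tens_of [:: (m, n)].

Lemma tens_of_sum s : tens_of s = \sum_(p <- s) tpure p.1 p.2.
Proof.
elim: s => [|[m n] s IHs]; first by rewrite big_nil.
by rewrite big_cons -IHs -cat1s tens_ofD.
Qed.

Lemma tens_sum (t : tens) : t = \sum_(p <- repr t) tpure p.1 p.2.
Proof. by rewrite -tens_of_sum tens_reprK. Qed.

Lemma tpureDl n : {morph tpure^~ n : m m' / m + m'}.
Proof.
move=> m m'; rewrite [LHS](proj1 (tens_ofP _ _) (Tens_addl _ _ _)).
exact: (tens_ofD [:: (m, n)] [:: (m', n)]).
Qed.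

Lemma tpureDr m : {morph tpure m : n n' / n + n'}.
Proof.
move=> n n'; rewrite [LHS](proj1 (tens_ofP _ _) (Tens_addr _ _ _)).
exact: (tens_ofD [:: (m, n)] [:: (m, n')]).
Qed.

Lemma tpure_act m x n : tpure (actr m x) n = tpure m (actl x n).
Proof. exact/tens_ofP/Tens_act. Qed.

Definition balanced (P : zmodType) (f : M -> N -> P) : Prop :=
  [/\ forall n, {morph f^~ n : m m' / m + m'},
      forall m, {morph f m : n n' / n + n'}
    & forall m x n, f (actr m x) n = f m (actl x n)].

Lemma balanced_tpure : balanced tpure.
Proof. by split; [exact: tpureDl|exact: tpureDr|exact: tpure_act]. Qed.

(* The additive map induced by f; meaningful only when f is balanced, as
   otherwise the value depends on the chosen representative (see tliftE). *)
Definition tlift (P : zmodType) (f : M -> N -> P) (t : tens) : P :=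
  \sum_(p <- repr t) f p.1 p.2.

Section Lift.
Variables (P : zmodType) (f : M -> N -> P).
Hypothesis fP : balanced f.

Lemma tens_rel_sum s t : tens_rel s t ->
  \sum_(p <- s) f p.1 p.2 = \sum_(p <- t) f p.1 p.2.
Proof.
have [fDl fDr fa] := fP.
elim=> {s t} //.
- by move=> s t u _ -> _ ->.
- by move=> s s' t t' _ + _; rewrite !big_cat /= => -> ->.
- by move=> s t; rewrite !big_cat /= addrC.
- move=> n; rewrite big_seq1 big_nil /=.
  by apply: (@addrI _ (f 0 n)); rewrite -fDl !addr0.
- by move=> m m' n; rewrite big_seq1 big_cons big_seq1 /= fDl.
- by move=> m n n'; rewrite big_seq1 big_cons big_seq1 /= fDr.
- by move=> m x n; rewrite !big_seq1 /= fa.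
Qed.

Lemma tlift_of s : tlift f (tens_of s) = \sum_(p <- s) f p.1 p.2.
Proof. exact/tens_rel_sum/tens_repr_of. Qed.

Lemma tliftE m n : tlift f (tpure m n) = f m n.
Proof. by rewrite tlift_of big_seq1. Qed.

Lemma tliftD : {morph tlift f : t u / t + u}.
Proof.
move=> t u; rewrite -[t]tens_reprK -[u]tens_reprK.
by rewrite -[_ + _]tens_ofD !tlift_of big_cat.
Qed.

Lemma tlift0 : tlift f 0 = 0.
Proof. by rewrite -[0]/(tens_of [::]) tlift_of big_nil. Qed.

End Lift.

Lemma tens_ind (Q : tens -> Prop) : Q 0 ->
  (forall t u, Q t -> Q u -> Q (t + u)) -> (forall m n, Q (tpure m n)) ->
  forall t, Q t.
Proof.
move=> Q0 QD Qp t; rewrite (tens_sum t).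
by elim/big_ind: _ => // p _; apply: Qp.
Qed.

End TensorProduct.

Notation "\tsum_ ( a , b <- t ) E" := (tlift (fun a b => E) t) : ring_scope.

Section TensorOverBase.
Variables (k : comPzRingType) (M N : lmodType k).

Definition ktens : Type :=
  @tens k M N (fun m x => x *: m) (fun x n => x *: n).

HB.instance Definition _ := GRing.Zmodule.on ktens.

Definition kpure (m : M) (n : N) : ktens := tpure _ _ m n.

Definition ktens_scale (x : k) (t : ktens) : ktens :=
  \tsum_(m, n <- t) kpure (x *: m) n.

Lemma kpureDl n : {morph kpure^~ n : m m' / m + m'}.
Proof. exact: tpureDl. Qed.

Lemma kpureDr m : {morph kpure m : n n' / n + n'}.
Proof. exact: tpureDr. Qed.

Lemma kpureZ x m n : kpure (x *: m) n = kpure m (x *: n).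
Proof. exact: tpure_act. Qed.

Lemma ktens_scale_balanced x :
  balanced (fun m y => y *: m) (fun y n => y *: n)
    (fun m n => kpure (x *: m) n).
Proof.
split=> [n m m'|m n n'|m y n]; first by rewrite scalerDr kpureDl.
  by rewrite kpureDr.
by rewrite !scalerA mulrC -scalerA kpureZ.
Qed.

Lemma ktens_scale_pure x m n : ktens_scale x (kpure m n) = kpure (x *: m) n.
Proof. exact: tliftE (ktens_scale_balanced x) _ _. Qed.

Lemma ktens_scaleD x : {morph ktens_scale x : t u / t + u}.
Proof. exact: tliftD (ktens_scale_balanced x). Qed.

Lemma ktens_scale0 x : ktens_scale x 0 = 0.
Proof. exact: tlift0 (ktens_scale_balanced x). Qed.

Fact ktens_scaleA x y t :
  ktens_scale x (ktens_scale y t) = ktens_scale (x * y) t.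
Proof.
elim/tens_ind: t => [|t u IHt IHu|m n]; first by rewrite !ktens_scale0.
  by rewrite !ktens_scaleD IHt IHu.
by rewrite !ktens_scale_pure scalerA.
Qed.

Fact ktens_scale1 : left_id 1 ktens_scale.
Proof.
elim/tens_ind=> [|t u IHt IHu|m n]; first by rewrite !ktens_scale0.
  by rewrite !ktens_scaleD IHt IHu.
by rewrite !ktens_scale_pure scale1r.
Qed.

Fact ktens_scaleDl t : {morph ktens_scale^~ t : x y / x + y}.
Proof.
move=> x y; elim/tens_ind: t => [|t u IHt IHu|m n].
- by rewrite !ktens_scale0 addr0.
- by rewrite !ktens_scaleD IHt IHu addrACA.
- by rewrite !ktens_scale_pure scalerDl kpureDl.
Qed.

HB.instance Definition _ := GRing.Zmodule_isLmodule.Build k ktens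
  ktens_scaleA ktens_scale1 ktens_scaleD ktens_scaleDl.

End TensorOverBase.

Notation "M ⊗ N" := (ktens M%type N%type) (at level 40, left associativity) : type_scope.
Notation "m ⊗ n" := (kpure m n) (at level 40, left associativity) : ring_scope.

Section TensorMaps.
Variable k : comPzRingType.

Definition kbilinear (M N P : lmodType k) (f : M -> N -> P) : Prop :=
  (forall n, linear (f^~ n)) /\ (forall m, linear (f m)).

Lemma kbilinear_balanced (M N P : lmodType k) (f : M -> N -> P) :
  kbilinear f ->
  balanced (fun m x => x *: m) (fun x n => x *: n) f.
Proof.
move=> [fl fr]; split=> [n m m'|m n n'|m x n].
- by have:= fl n 1 m m'; rewrite !scale1r.
- by have:= fr m 1 n n'; rewrite !scale1r.
- have f0l : f 0 n = 0.
    have:= fl n 1 0 0; rewrite /= !scale1r addr0 -[LHS]addr0.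
    by move=> /addrI <-.
  have f0r : f m 0 = 0.
    have:= fr m 1 0 0; rewrite !scale1r addr0 -[LHS]addr0.
    by move=> /addrI <-.
  have:= fl n x m 0; have:= fr m x n 0.
  by rewrite !addr0 f0l f0r !addr0 => -> ->.
Qed.

Lemma tlift_kpure (M N P : lmodType k) (f : M -> N -> P) m n :
  kbilinear f -> \tsum_(x, y <- m ⊗ n) f x y = f m n.
Proof. by move=> /kbilinear_balanced/tliftE; apply. Qed.

Lemma kpure_bilinear (M N : lmodType k) : kbilinear (@kpure k M N).
Proof.
have Zl (x : k) (m : M) (n : N) : x *: (m ⊗ n) = (x *: m) ⊗ n.
  exact: ktens_scale_pure.
split=> [n x m m'|m x n n']; first by rewrite kpureDl Zl.
by rewrite kpureDr Zl kpureZ.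
Qed.

Lemma tlift_linear (M N P : lmodType k) (f : M -> N -> P) :
  kbilinear f -> linear (fun t : M ⊗ N => \tsum_(x, y <- t) f x y).
Proof.
move=> fP x t u; have fB := kbilinear_balanced fP.
rewrite [LHS](tliftD fB); congr (_ + _).
have D t1 u1 : (x *: (t1 + u1) : M ⊗ N) = x *: t1 + x *: u1.
  exact: scalerDr.
elim/tens_ind: t => [|t1 t2 IH1 IH2|m n].
- by rewrite [x *: _]scaler0 !(tlift0 fB) scaler0.
- by rewrite D !(tliftD fB) IH1 IH2 scalerDr.
- have -> : x *: (tpure _ _ m n : M ⊗ N) = (x *: m) ⊗ n.
    exact: ktens_scale_pure.
  rewrite !(tliftE fB).
  have f0 : f 0 n = 0.
    by case: fB => fl _ _; apply: (@addrI _ (f 0 n)); rewrite -fl !addr0.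
  by have:= fP.1 n x m 0; rewrite /= f0 !addr0.
Qed.

Definition tmap (M M' N N' : lmodType k) (f : M -> M') (g : N -> N')
  (t : M ⊗ N) : M' ⊗ N' := \tsum_(m, n <- t) f m ⊗ g n.

Definition tassoc (M N P : lmodType k) (t : M ⊗ (N ⊗ P)) : M ⊗ N ⊗ P :=
  \tsum_(m, u <- t) \tsum_(n, p <- u) m ⊗ n ⊗ p.

Definition tassocV (M N P : lmodType k) (t : M ⊗ N ⊗ P) : M ⊗ (N ⊗ P) :=
  \tsum_(u, p <- t) \tsum_(m, n <- u) m ⊗ (n ⊗ p).

End TensorMaps.


Definition coassociative (k : comPzRingType) (C : lmodType k)
    (comul : C -> C ⊗ C) : Prop :=
  forall c, tassoc (tmap idfun comul (comul c)) = tmap comul idfun (comul c).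

Definition counital (k : comPzRingType) (C : lmodType k)
    (comul : C -> C ⊗ C) (counit : C -> k) : Prop :=
  forall c, \tsum_(c1, c2 <- comul c) counit c1 *: c2 = c /\
            \tsum_(c1, c2 <- comul c) counit c2 *: c1 = c.

HB.mixin Record Lmodule_isCoalgebra (k : comPzRingType) C
    of GRing.Lmodule k C := {
  comul : {linear C -> @ktens k C C};
  counit : {scalar C};
  comulA : @coassociative k C comul;
  comulK : @counital k C comul counit
}.

#[short(type="coalgType")]
HB.structure Definition Coalgebra (k : comPzRingType) :=
  {C of GRing.Lmodule k C & Lmodule_isCoalgebra k C}.

Section Comodule.
Variables (k : comPzRingType) (C : coalgType k).

Definition is_comodule (M : lmodType k) (rho : {linear M -> (M ⊗ C)%type}) : Prop :=
  (forall m, tassoc (tmap idfun comul (rho m)) = tmap rho idfun (rho m)) /\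
  (forall m, \tsum_(m0, m1 <- rho m) counit m1 *: m0 = m).

End Comodule.

Section RingExtension.
Variables (k : comPzRingType) (A : algType k) (B : subalgClosed A).

Definition btens : Type :=
  @tens {b : A | b \in B} A A
    (fun a b => a * val b) (fun b a => val b * a).

HB.instance Definition _ := GRing.Zmodule.on btens.

Definition bpure (a a' : A) : btens := tpure _ _ a a'.

Definition bbalanced (P : zmodType) (f : A -> A -> P) : Prop :=
  [/\ forall y, {morph f^~ y : x x' / x + x'},
      forall x, {morph f x : y y' / y + y'}
    & forall x b y, b \in B -> f (x * b) y = f x (b * y)].

Lemma tlift_bpure (P : zmodType) (f : A -> A -> P) a a' :
  bbalanced f -> \tsum_(x, y <- bpure a a') f x y = f a a'.
Proof.
move=> [fl fr fB]; apply: tliftE.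
by split=> [//|//|m [b Bb] n /=]; apply: fB.
Qed.

Definition blact (a : A) (u : btens) : btens :=
  \tsum_(x, y <- u) bpure (a * x) y.
Definition bract (u : btens) (a : A) : btens :=
  \tsum_(x, y <- u) bpure x (y * a).
Definition bmul (u : btens) : A := \tsum_(x, y <- u) x * y.

Lemma bpureDl y : {morph bpure^~ y : x x' / x + x'}.
Proof. exact: tpureDl. Qed.

Lemma bpureDr x : {morph bpure x : y y' / y + y'}.
Proof. exact: tpureDr. Qed.

Lemma bpureM x b y : b \in B -> bpure (x * b) y = bpure x (b * y).
Proof. by move=> Bb; apply: (@tpure_act _ _ _ _ _ x (Sub b Bb) y). Qed.

Lemma bbalancedW (P : zmodType) (f : A -> A -> P) : bbalanced f ->
  balanced (fun a (b : {b : A | b \in B}) => a * val b)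
    (fun b a => val b * a) f.
Proof.
by case=> fl fr fB; split=> // x [b Bb] y; apply: fB.
Qed.

Lemma blact_bbalanced a : bbalanced (fun x y => bpure (a * x) y).
Proof.
split=> [y x x'|x y y'|x b y Bb]; first by rewrite mulrDr bpureDl.
  by rewrite bpureDr.
by rewrite mulrA bpureM.
Qed.

Lemma bract_bbalanced a : bbalanced (fun x y => bpure x (y * a)).
Proof.
split=> [y x x'|x y y'|x b y Bb]; first by rewrite bpureDl.
  by rewrite mulrDl bpureDr.
by rewrite bpureM // mulrA.
Qed.

Lemma blact_bpure a x y : blact a (bpure x y) = bpure (a * x) y.
Proof. exact: tlift_bpure (blact_bbalanced a). Qed.

Lemma bract_bpure a x y : bract (bpure x y) a = bpure x (y * a).
Proof. exact: tlift_bpure (bract_bbalanced a). Qed.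

Lemma blactD a : {morph blact a : u v / u + v}.
Proof. exact: tliftD (bbalancedW (blact_bbalanced a)). Qed.

Lemma bractD a : {morph bract^~ a : u v / u + v}.
Proof. exact: tliftD (bbalancedW (bract_bbalanced a)). Qed.

Lemma blact0 a : blact a 0 = 0.
Proof. exact: tlift0 (bbalancedW (blact_bbalanced a)). Qed.

Lemma bract0 a : bract 0 a = 0.
Proof. exact: tlift0 (bbalancedW (bract_bbalanced a)). Qed.

Lemma btens_ind (Q : btens -> Prop) : Q 0 ->
  (forall u v, Q u -> Q v -> Q (u + v)) -> (forall x y, Q (bpure x y)) ->
  forall u, Q u.
Proof. exact: tens_ind. Qed.

Lemma blact_bract a b u : blact a (bract u b) = bract (blact a u) b.
Proof.
elim/btens_ind: u => [|u v IHu IHv|x y].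
- by rewrite bract0 !blact0 bract0.
- by rewrite bractD !blactD bractD IHu IHv.
- by rewrite bract_bpure !blact_bpure bract_bpure.
Qed.

Definition separability_idempotent (u : btens) : Prop :=
  (forall a, blact a u = bract u a) /\ bmul u = 1.

Definition separable_ext : Prop := exists u, separability_idempotent u.

(* A map to B is given as a map to A with values in B.  As B contains k, a
   bimodule map is k-linear. *)
Definition conditional_expectation (E : {additive A -> A}) : Prop :=
  [/\ forall a, E a \in B, E 1 = 1
    & forall b a b', b \in B -> b' \in B -> E (b * a * b') = b * E a * b'].

Definition split_ext : Prop := exists E, conditional_expectation E.

End RingExtension.

Arguments separable_ext {k A} B.
Arguments split_ext {k A} B.

Definition strongly_separable_ext
    (k : comUnitRingType) (A : algType k) (B : subalgClosed A) : Prop :=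
  [/\ separable_ext B, split_ext B
    & exists (u : btens B) (E : {additive A -> A}) (tau : k),
      [/\ separability_idempotent u, conditional_expectation B E,
          tau \is a GRing.unit,
          forall a, \tsum_(x, y <- u) E (a * x) * y = tau *: a
        & forall a, \tsum_(x, y <- u) x * E (y * a) = tau *: a]].

Section LeftAction.
Variables (k : comPzRingType) (C : lmodType k) (A : algType k).

Definition lact (a : A) (t : A ⊗ C) : A ⊗ C := tmap ( *%R a) idfun t.

Lemma lact_kbilinear a : @kbilinear k A C _ (fun a' c => (a * a') ⊗ c).
Proof.
have [pl pr] := @kpure_bilinear k A C.
split=> [c x m m'|m x c c']; last by rewrite pr.
by rewrite mulrDr -scalerAr pl.
Qed.

Lemma lact_linear a : linear (lact a).
Proof. exact: tlift_linear (lact_kbilinear a). Qed.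

HB.instance Definition _ a :=
  GRing.isLinear.Build k (A ⊗ C)%type (A ⊗ C)%type *:%R (lact a) (lact_linear a).

Lemma lact_kpure a a' (c : C) : lact a (a' ⊗ c) = (a * a') ⊗ c.
Proof. exact: tlift_kpure (lact_kbilinear a). Qed.

Lemma ktens_ind (Q : A ⊗ C -> Prop) : Q 0 ->
  (forall t u, Q t -> Q u -> Q (t + u)) -> (forall a c, Q (a ⊗ c)) ->
  forall t, Q t.
Proof. exact: tens_ind. Qed.

Lemma lactD a : {morph lact a : t u / t + u}.
Proof. exact: linearD. Qed.

Lemma lact0 a : lact a 0 = 0.
Proof. exact: linear0. Qed.

Lemma lactA a b t : lact (a * b) t = lact a (lact b t).
Proof.
elim/ktens_ind: t => [|t u IHt IHu|m n]; first by rewrite !lact0.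
  by rewrite !lactD IHt IHu.
by rewrite !lact_kpure mulrA.
Qed.

Lemma lact1 t : lact 1 t = t.
Proof.
elim/ktens_ind: t => [|t u IHt IHu|m n]; first by rewrite lact0.
  by rewrite lactD IHt IHu.
by rewrite lact_kpure mul1r.
Qed.

Lemma lactP x a b t : lact (x *: a + b) t = x *: lact a t + lact b t.
Proof.
have [pl _] := @kpure_bilinear k A C.
elim/ktens_ind: t => [|t u IHt IHu|m n].
- by rewrite !lact0 scaler0 addr0.
- by rewrite !lactD IHt IHu scalerDr addrACA.
- by rewrite !lact_kpure mulrDl -scalerAl pl.
Qed.

End LeftAction.

Section Galois.
Variables (k : comPzRingType) (C : coalgType k) (A : algType k).
Variable rho : {linear A -> (A ⊗ C)%type}.

Definition coinv : {pred A} :=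
  [pred b | `[< forall a, rho (b * a) = lact b (rho a) >]].

Lemma coinvP b :
  reflect (forall a, rho (b * a) = lact b (rho a)) (b \in coinv).
Proof. exact: asboolP. Qed.

Fact coinv_subalg_closed : subalg_closed coinv.
Proof.
split=> [|x b b' /coinvP Bb /coinvP Bb'|b b' /coinvP Bb /coinvP Bb'];
    apply/coinvP=> a.
- by rewrite mul1r lact1.
- by rewrite mulrDl -scalerAl linearP Bb Bb' lactP.
- by rewrite -mulrA Bb Bb' lactA.
Qed.

HB.instance Definition _ :=
  GRing.isSubalgClosed.Build k A coinv coinv_subalg_closed.

Definition can (u : btens coinv) : A ⊗ C := \tsum_(a, a' <- u) lact a (rho a').

Definition is_coalgebra_galois : Prop := is_comodule rho /\ bijective can.

Definition can_inv (t : A ⊗ C) : btens coinv := xget 0 [set u | can u = t].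

Definition psi_can (t : C ⊗ A) : A ⊗ C :=
  \tsum_(c, a <- t) can (bract (can_inv (1 ⊗ c)) a).

Lemma can_bbalanced : bbalanced coinv (fun a a' => lact a (rho a')).
Proof.
split=> [y x x'|x y y'|x b y /coinvP Bb].
- by have:= lactP 1 x x' (rho y); rewrite !scale1r.
- by rewrite linearD lactD.
- by rewrite Bb lactA.
Qed.

Lemma can_bpure a a' : can (bpure coinv a a') = lact a (rho a').
Proof. exact: tlift_bpure can_bbalanced. Qed.

Lemma canD : {morph can : u v / u + v}.
Proof. exact: tliftD (bbalancedW can_bbalanced). Qed.

Lemma can0 : can 0 = 0.
Proof. exact: tlift0 (bbalancedW can_bbalanced). Qed.

Lemma can_blact a u : can (blact a u) = lact a (can u).
Proof.
elim/btens_ind: u => [|u v IHu IHv|x y].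
- by rewrite blact0 can0 lact0.
- by rewrite blactD !canD lactD IHu IHv.
- by rewrite blact_bpure !can_bpure lactA.
Qed.

Lemma can_bractP u x a b :
  can (bract u (x *: a + b)) = x *: can (bract u a) + can (bract u b).
Proof.
elim/btens_ind: u => [|u v IHu IHv|y z].
- by rewrite !bract0 can0 scaler0 addr0.
- by rewrite !bractD !canD IHu IHv scalerDr addrACA.
- by rewrite !bract_bpure !can_bpure mulrDr -scalerAr !linearP.
Qed.

Hypothesis can_bij : bijective can.

Lemma can_invK : cancel can_inv can.
Proof.
move=> t; have [g _ gK] := can_bij.
exact: (@xgetPex _ 0 [set u | can u = t] (ex_intro _ (g t) (gK t))).
Qed.

Lemma canK : cancel can can_inv.
Proof. by move=> u; apply: (bij_inj can_bij); rewrite can_invK. Qed.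

Lemma psi_can_kbilinear :
  @kbilinear k C A _ (fun c a => can (bract (can_inv (1 ⊗ c)) a)).
Proof.
split=> [a x c c'|c x a a']; last exact: can_bractP.
have -> : can_inv (1 ⊗ (x *: c + c')) =
    blact (x *: 1) (can_inv (1 ⊗ c)) + can_inv (1 ⊗ c').
  apply: (bij_inj can_bij); rewrite canD can_blact !can_invK lact_kpure mulr1.
  by rewrite kpureZ kpureDr.
rewrite /= bractD canD -blact_bract can_blact.
have:= lactP x 1 0 (can (bract (can_inv (1 ⊗ c)) a)).
have l0 t : lact 0 t = 0 :> A ⊗ C.
  by have:= lactP (-1) 0 0 t; rewrite scaler0 addr0 scaleN1r addNr.
by rewrite addr0 lact1 l0 addr0 => ->.
Qed.

Lemma psi_can_kpure (c : C) a :
  psi_can (c ⊗ a) = can (bract (can_inv (1 ⊗ c)) a).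
Proof. exact: tlift_kpure psi_can_kbilinear. Qed.

Lemma psi_can_linear : linear psi_can.
Proof. exact: tlift_linear psi_can_kbilinear. Qed.

End Galois.

Section Integrals.
Variables (k : comPzRingType) (C : coalgType k) (A : algType k).
Variable psi : C ⊗ A -> A ⊗ C.

Definition is_integral (z : A ⊗ C) : Prop :=
  forall a, lact a z = \tsum_(ai, ci <- z) lact ai (psi (ci ⊗ a)).

Definition normalised_integral (z : A ⊗ C) : Prop :=
  is_integral z /\ \tsum_(ai, ci <- z) counit ci *: ai = 1.

Definition tmul (t : A ⊗ A) : A := \tsum_(a, a' <- t) a * a'.

Definition is_integral_map (gamma : {linear (C ⊗ C)%type -> A}) : Prop :=
  (forall t : C ⊗ C,
     tmap gamma idfun (tassoc (tmap idfun comul t)) =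
     psi (tmap idfun gamma (tassocV (tmap comul idfun t)))) /\
  (forall t : C ⊗ (C ⊗ A),
     tmul (tmap gamma idfun (tassoc t)) =
     tmul (tmap idfun gamma
       (tassocV (tmap psi idfun (tassoc (tmap idfun psi t)))))).

Definition normalised_integral_map (gamma : {linear (C ⊗ C)%type -> A}) : Prop :=
  is_integral_map gamma /\ forall c, gamma (comul c) = counit c *: 1.

End Integrals.

(* Main.v *)
Require Import Defs.
From HB Require Import structures.
From mathcomp Require Import all_boot all_algebra.

(** Everything is transported along the bijection can between A ⊗_B A and
A ⊗ C.  The product of A on the right factor of A ⊗_B A becomes the right
action (a ⊗ c) · a' = a ψ(c ⊗ a') of A on A ⊗ C ([can_bract]), so a normalised
integral z is the same thing as a separability idempotent u, with can(u) = z.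

For the conditional expectation, put G(a ⊗ c) = a_(0) γ(a_(1) ⊗ c) and
E(a) = G(a ρ(1)).  The second identity of an integral map says that G is right
A-linear for the action above ([expectl_entw_act]), hence
      E(a) a' = G(can(a ⊗ a')) = G(a ρ(a')),
and the first one, with coassociativity of ρ, says that G is right C-colinear
([rho_expectl]).  Colinearity gives ρ(E(a) a') = E(a) ρ(a'), that is, E(a) lies
in B; linearity gives E(a b) = E(a) b for b in B; left B-linearity is the
definition of B; and E(1) = G(ρ(1)) = 1 is the normalisation of γ.

So G is the map E ⊗ A followed by the product, read on A ⊗ C.  In the same way
J(a ⊗ c) = a 1_(0)α γ(c^α ⊗ 1_(1)) is the map A ⊗ E followed by the product
([expectr_rho]).  Conditions (ii) and (i) are thus G(z) = τ and J(z) = τ, which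
are the two identities of strong separability at a = 1.  The general case
follows since G is right A-linear, J is left A-linear and a z = z · a. *)

Set Implicit Arguments.
Unset Strict Implicit.
Unset Printing Implicit Defensive.

Import GRing.Theory.
Local Open Scope ring_scope.

(** * Sums over tensors *)

(** A sum over a tensor is a finite sum over a chosen representative.  Pushing
an additive map through it, or exchanging two such sums, therefore requires no
condition on the summand; only the facts that change the tensor summed over
require the summand to be bilinear. *)
Section SumsOverTensors.
Variables (S : Type) (M N : zmodType).
Variables (actr : M -> S -> M) (actl : S -> N -> N).
Implicit Type t : tens actr actl.

Lemma eq_tsum (P : zmodType) (f g : M -> N -> P) t :
  (forall m n, f m n = g m n) ->
  \tsum_(m, n <- t) f m n = \tsum_(m, n <- t) g m n.
Proof. by move=> fg; apply: eq_bigr => p _; apply: fg. Qed.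

Lemma mulr_tsumr (R : pzRingType) (a : R) (f : M -> N -> R) t :
  a * (\tsum_(m, n <- t) f m n) = \tsum_(m, n <- t) (a * f m n).
Proof. exact: mulr_sumr. Qed.

Lemma mulr_tsuml (R : pzRingType) (a : R) (f : M -> N -> R) t :
  (\tsum_(m, n <- t) f m n) * a = \tsum_(m, n <- t) (f m n * a).
Proof. exact: mulr_suml. Qed.

Lemma exchange_tsum (S' : Type) (M' N' P : zmodType)
    (actr' : M' -> S' -> M') (actl' : S' -> N' -> N')
    (f : M -> N -> M' -> N' -> P) t (t' : tens actr' actl') :
  \tsum_(m, n <- t) \tsum_(x, y <- t') f m n x y =
  \tsum_(x, y <- t') \tsum_(m, n <- t) f m n x y.
Proof. exact: exchange_big. Qed.

Lemma linear_tsum (k : pzRingType) (P Q : lmodType k) (L : P -> Q)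
    (f : M -> N -> P) t :
  linear L -> L (\tsum_(m, n <- t) f m n) = \tsum_(m, n <- t) L (f m n).
Proof.
move=> Ll.
pose L0 : {linear P -> Q} := HB.pack L (GRing.isLinear.Build _ _ _ _ L Ll).
exact: (raddf_sum L0).
Qed.

End SumsOverTensors.

(** * Linearity of maps given by tensor expressions *)

Section LinearExpressions.
Variable k : comPzRingType.
Implicit Types M N P Q : lmodType k.

Lemma linear_fun_comp M N P (f : N -> P) (g : M -> N) :
  linear f -> linear g -> linear (fun m => f (g m)).
Proof. by move=> fl gl x m m'; rewrite gl fl. Qed.

Lemma linear_fun_tsum M N P Q (f : Q -> M -> N -> P) (t : (M ⊗ N)%type) :
  (forall m n, linear (fun q => f q m n)) ->
  linear (fun q => \tsum_(m, n <- t) f q m n).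
Proof.
move=> fl x q q'; rewrite /tlift scaler_sumr -big_split.
by apply: eq_bigr => p _; apply: fl.
Qed.

Lemma linear_fun_tsum_arg M N P Q (f : M -> N -> P) (L : Q -> (M ⊗ N)%type) :
  kbilinear f -> linear L -> linear (fun q => \tsum_(m, n <- L q) f m n).
Proof. by move=> /tlift_linear; apply: linear_fun_comp. Qed.

Lemma linear_fun_id M : linear (fun m : M => m).
Proof. by []. Qed.

Lemma linear_idfun M : linear (@idfun M).
Proof. by []. Qed.

Lemma linear_fun_app M N P (L : {linear N -> P}) (h : M -> N) :
  linear h -> linear (fun m => L (h m)).
Proof. by move=> hl x m m'; rewrite hl linearP. Qed.

Lemma linear_fun_kpurel M N P (h : P -> M) (n : N) :
  linear h -> linear (fun p => h p ⊗ n).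
Proof. by move=> hl x p p'; rewrite hl (kpure_bilinear M N).1. Qed.

Lemma linear_fun_kpurer M N P (m : M) (h : P -> N) :
  linear h -> linear (fun p => m ⊗ h p).
Proof. by move=> hl x p p'; rewrite hl (kpure_bilinear M N).2. Qed.

Lemma linear_fun_mull M (A : algType k) (h : M -> A) (a : A) :
  linear h -> linear (fun m => h m * a).
Proof. by move=> hl x m m'; rewrite hl mulrDl -scalerAl. Qed.

Lemma linear_fun_mulr M (A : algType k) (a : A) (h : M -> A) :
  linear h -> linear (fun m => a * h m).
Proof. by move=> hl x m m'; rewrite hl mulrDr -scalerAr. Qed.

Lemma linear_fun_lactl M (C : lmodType k) (A : algType k) (h : M -> A)
    (t : (A ⊗ C)%type) : linear h -> linear (fun m => lact (h m) t).
Proof. by move=> hl x m m'; rewrite hl lactP. Qed.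

End LinearExpressions.

(** The last alternative splits bilinearity into linearity in each variable. *)
Ltac linear_step := first
  [ exact: linear_fun_id | assumption | exact: linearP
  | apply: linear_fun_kpurel | apply: linear_fun_kpurer
  | apply: linear_fun_mull | apply: linear_fun_mulr
  | apply: linear_fun_app | apply: linear_fun_lactl
  | apply: linear_fun_tsum => ? ? | apply: linear_fun_tsum_arg
  | split => ? ].
Ltac solve_linear := repeat linear_step.

(** * Tensor products of maps and the associator *)

Section TensorCalculus.
Variable k : comPzRingType.
Implicit Types M N P Q : lmodType k.

Lemma tsum_tsum S (M' N' : zmodType) (actr : M' -> S -> M')
    (actl : S -> N' -> N') M N P (f : M -> N -> P)
    (g : M' -> N' -> (M ⊗ N)%type) (t : tens actr actl) :
  kbilinear f ->
  \tsum_(m, n <- \tsum_(x, y <- t) g x y) f m n =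
  \tsum_(x, y <- t) \tsum_(m, n <- g x y) f m n.
Proof. by move=> /tlift_linear/linear_tsum->. Qed.

Lemma tsum_kpure M N (t : (M ⊗ N)%type) : \tsum_(m, n <- t) m ⊗ n = t.
Proof. by rewrite [RHS](tens_sum t). Qed.

Lemma tsum_tmap M M' N N' P (h : M -> M') (g : N -> N') (f : M' -> N' -> P)
    (t : (M ⊗ N)%type) :
  kbilinear f ->
  \tsum_(x, y <- tmap h g t) f x y = \tsum_(m, n <- t) f (h m) (g n).
Proof.
by move=> fP; rewrite tsum_tsum //; apply: eq_tsum => m n; apply: tlift_kpure.
Qed.

Lemma tmap_linear M M' N N' (h : M -> M') (g : N -> N') :
  linear h -> linear g -> linear (tmap h g).
Proof. by move=> hl gl; apply: tlift_linear; solve_linear. Qed.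

Lemma tmap_kpure M M' N N' (h : M -> M') (g : N -> N') m n :
  linear h -> linear g -> tmap h g (m ⊗ n) = h m ⊗ g n.
Proof. by move=> hl gl; apply: tlift_kpure; solve_linear. Qed.

Lemma tmap_tsum S (M0 N0 : zmodType) (actr : M0 -> S -> M0)
    (actl : S -> N0 -> N0) M M' N N' (h : M -> M') (g : N -> N')
    (m : M0 -> N0 -> M) (n : M0 -> N0 -> N) (t : tens actr actl) :
  linear h -> linear g ->
  tmap h g (\tsum_(x, y <- t) m x y ⊗ n x y) =
  \tsum_(x, y <- t) h (m x y) ⊗ g (n x y).
Proof.
move=> hl gl; rewrite (linear_tsum _ _ (tmap_linear hl gl)).
by apply: eq_tsum => x y; apply: tmap_kpure.
Qed.

Lemma tassoc_kbilinear M N P :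
  kbilinear (fun (m : M) (u : (N ⊗ P)%type) => \tsum_(n, p <- u) m ⊗ n ⊗ p).
Proof. by solve_linear. Qed.

Lemma tassocV_kbilinear M N P :
  kbilinear (fun (u : (M ⊗ N)%type) (p : P) => \tsum_(m, n <- u) m ⊗ (n ⊗ p)).
Proof. by solve_linear. Qed.

Lemma tassoc_linear M N P : linear (@tassoc k M N P).
Proof. exact: (tlift_linear (tassoc_kbilinear M N P)). Qed.

Lemma tassoc_kpure M N P (m : M) (u : (N ⊗ P)%type) :
  tassoc (m ⊗ u) = \tsum_(n, p <- u) m ⊗ n ⊗ p.
Proof. exact: (tlift_kpure _ _ (tassoc_kbilinear M N P)). Qed.

Lemma tassocV_linear M N P : linear (@tassocV k M N P).
Proof. exact: (tlift_linear (tassocV_kbilinear M N P)). Qed.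

Lemma tassocV_kpure M N P (u : (M ⊗ N)%type) (p : P) :
  tassocV (u ⊗ p) = \tsum_(m, n <- u) m ⊗ (n ⊗ p).
Proof. exact: (tlift_kpure _ _ (tassocV_kbilinear M N P)). Qed.

Definition ktrilinear M N P Q (f : M -> N -> P -> Q) : Prop :=
  (forall p, kbilinear (fun m n => f m n p)) /\
  (forall m n, linear (f m n)).

Lemma ktrilinear_tsum M N P Q (f : M -> N -> P -> Q) :
  ktrilinear f ->
  kbilinear (fun (w : (M ⊗ N)%type) p => \tsum_(m, n <- w) f m n p).
Proof.
case=> fb fl; split=> [p|w]; first exact: tlift_linear.
exact: linear_fun_tsum.
Qed.

Lemma tsum_tassoc M N P Q (f : M -> N -> P -> Q) (m : M) (u : (N ⊗ P)%type) :
  ktrilinear f ->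
  \tsum_(w, p <- tassoc (m ⊗ u)) \tsum_(x, y <- w) f x y p =
  \tsum_(n, p <- u) f m n p.
Proof.
move=> fP; have fP2 := ktrilinear_tsum fP.
rewrite tassoc_kpure; apply: etrans (tsum_tsum _ _ fP2) _.
apply: eq_tsum => n p; apply: etrans (tlift_kpure _ _ fP2) _.
exact: tlift_kpure (fP.1 p).
Qed.

Section Product.
Variable A : algType k.

Lemma mul_kbilinear : @kbilinear k A A A (fun x y => x * y).
Proof. by solve_linear. Qed.

Lemma tmul_linear : linear (@tmul k A).
Proof. exact: tlift_linear mul_kbilinear. Qed.

Lemma tmul_kpure (x y : A) : tmul (x ⊗ y) = x * y.
Proof. exact: tlift_kpure mul_kbilinear. Qed.

Lemma tmul_tsum S (M N : zmodType) (actr : M -> S -> M) (actl : S -> N -> N)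
    (f g : M -> N -> A) (t : tens actr actl) :
  tmul (\tsum_(x, y <- t) f x y ⊗ g x y) = \tsum_(x, y <- t) f x y * g x y.
Proof.
rewrite (linear_tsum _ _ tmul_linear).
by apply: eq_tsum => x y; apply: tmul_kpure.
Qed.

Lemma tsum_lact N P (f : A -> N -> P) (a : A) (t : (A ⊗ N)%type) :
  kbilinear f ->
  \tsum_(y, e <- lact a t) f y e = \tsum_(y, e <- t) f (a * y) e.
Proof. exact: tsum_tmap. Qed.

End Product.

End TensorCalculus.

(** * The right action of A on A ⊗ C *)

Section GaloisExtension.
Variables (k : comPzRingType) (C : coalgType k) (A : algType k).
Variable rho : {linear A -> (A ⊗ C)%type}.
Implicit Types (t : (A ⊗ C)%type) (u : btens (coinv rho)) (a b : A) (c d : C).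

(** Coassociativity of the coaction in the form in which it acts on sums:
a_(0)(0) ⊗ a_(0)(1) ⊗ a_(1) may be replaced by a_(0) ⊗ a_(1) ⊗ a_(2). *)
Lemma rho_coassoc (P : lmodType k) (f : A -> C -> C -> P) a :
  is_comodule rho -> ktrilinear f ->
  \tsum_(x, d <- rho a) \tsum_(y, e <- rho x) f y e d =
  \tsum_(x, c <- rho a) \tsum_(d, e <- comul c) f x d e.
Proof.
move=> [rhoA _] fP; have fP2 := ktrilinear_tsum fP.
rewrite -(tsum_tmap rho idfun (rho a) fP2) -rhoA.
rewrite (linear_tsum _ _ (@tassoc_linear _ A C C)) tsum_tsum //.
by apply: eq_tsum => x c; apply: tsum_tassoc.
Qed.

Hypothesis galois : is_coalgebra_galois rho.
Let rho_comod : is_comodule rho := galois.1.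
Let can_bij : bijective (can (rho:=rho)) := galois.2.
Local Notation psi := (psi_can rho).

Lemma psi_linear : linear psi.
Proof. exact: psi_can_linear can_bij. Qed.

Definition entw_act t a : (A ⊗ C)%type := \tsum_(x, c <- t) lact x (psi (c ⊗ a)).

Lemma entw_act_kbilinear a : kbilinear (fun x c => lact x (psi (c ⊗ a))).
Proof.
split=> [c|x]; first by solve_linear.
by apply: linear_fun_app; apply: (linear_fun_comp psi_linear); solve_linear.
Qed.

Lemma entw_act_linear a : linear (entw_act^~ a).
Proof. exact: tlift_linear (entw_act_kbilinear a). Qed.

Lemma entw_act_kpure x c a : entw_act (x ⊗ c) a = lact x (psi (c ⊗ a)).
Proof. exact: tlift_kpure (entw_act_kbilinear a). Qed.

(** By definition of psi this holds for the preimages of the tensors 1 ⊗ c, and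
these generate A ⊗_B A under the left action of A, which commutes with the
right action. *)
Lemma can_bract u a : can (bract u a) = entw_act (can u) a.
Proof.
have act0 : entw_act 0 a = 0.
  exact: tlift0 (kbilinear_balanced (entw_act_kbilinear a)).
have actD t t' : entw_act (t + t') a = entw_act t a + entw_act t' a.
  exact: tliftD (kbilinear_balanced (entw_act_kbilinear a)) t t'.
rewrite -{1}(canK can_bij u).
elim/ktens_ind: (can (rho:=rho) u) => [|t t' IH IH'|x c].
- have -> : can_inv rho 0 = 0.
    by apply: (bij_inj can_bij); rewrite (can_invK can_bij) can0.
  by rewrite bract0 can0 act0.
- have -> : can_inv rho (t + t') = can_inv rho t + can_inv rho t'.
    by apply: (bij_inj can_bij); rewrite canD !(can_invK can_bij).
  by rewrite bractD canD IH IH' actD.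
- have -> : can_inv rho (x ⊗ c) = blact x (can_inv rho (1 ⊗ c)).
    apply: (bij_inj can_bij).
    by rewrite can_blact !(can_invK can_bij) lact_kpure mulr1.
  by rewrite -blact_bract can_blact -(psi_can_kpure can_bij) entw_act_kpure.
Qed.

Lemma entw_act_lact_rho x a b : entw_act (lact x (rho a)) b = lact x (rho (a * b)).
Proof. by rewrite -can_bpure -can_bract bract_bpure can_bpure. Qed.

(** This says that A is an entwined module. *)
Lemma entw_act_rho a b : entw_act (rho a) b = rho (a * b).
Proof. by rewrite -[rho a]lact1 entw_act_lact_rho lact1. Qed.

Lemma can_bract_tsum u a :
  can (bract u a) = \tsum_(x, y <- u) lact x (rho (y * a)).
Proof.
rewrite can_bract (linear_tsum _ _ (entw_act_linear a)).
by apply: eq_tsum => x y; apply: entw_act_lact_rho.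
Qed.

(** * Separability idempotents from integrals *)

Lemma bmul_can u : bmul u = \tsum_(a, c <- can u) counit c *: a.
Proof.
have epsP : @kbilinear k A C A (fun a c => counit c *: a).
  split=> [c x a a'|a x c c']; first by rewrite scalerDr !scalerA mulrC.
  by rewrite linearP scalerDl scalerA.
rewrite tsum_tsum //; apply: eq_tsum => x y.
rewrite tsum_lact // -{1}[y]rho_comod.2 mulr_tsumr.
by apply: eq_tsum => a c; rewrite scalerAr.
Qed.

Lemma can_inv_separability_idempotent t :
  normalised_integral psi t -> separability_idempotent (can_inv rho t).
Proof.
case=> t_int t_norm; split=> [a|]; last by rewrite bmul_can (can_invK can_bij).
apply: (bij_inj can_bij).
by rewrite can_blact can_bract (can_invK can_bij) t_int.
Qed.

(** * The conditional expectation of an integral map *)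

Variable gamma : {linear (C ⊗ C)%type -> A}.

(** Under can, this is the map x ⊗ y |-> E(x) y for the conditional expectation
E below; see [expectation_mulr]. *)
Definition expectl t : A :=
  \tsum_(x, c <- t) \tsum_(y, d <- rho x) y * gamma (d ⊗ c).

Lemma expectl_kbilinear :
  kbilinear (fun x c => \tsum_(y, d <- rho x) y * gamma (d ⊗ c)).
Proof. by solve_linear. Qed.

Lemma expectl_linear : linear expectl.
Proof. exact: tlift_linear expectl_kbilinear. Qed.

HB.instance Definition _ :=
  GRing.isLinear.Build k (A ⊗ C)%type A *:%R expectl expectl_linear.

Lemma expectl_kpure x c :
  expectl (x ⊗ c) = \tsum_(y, d <- rho x) y * gamma (d ⊗ c).
Proof. exact: tlift_kpure expectl_kbilinear. Qed.

Definition expectation a : A := expectl (lact a (rho 1)).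

Lemma expectation_linear : linear expectation.
Proof. by rewrite /expectation; solve_linear. Qed.

HB.instance Definition _ :=
  GRing.isLinear.Build k A A *:%R expectation expectation_linear.

Lemma expectl_lact b t : b \in coinv rho -> expectl (lact b t) = b * expectl t.
Proof.
move=> /coinvP Bb; rewrite /expectl tsum_lact; last exact: expectl_kbilinear.
rewrite mulr_tsumr; apply: eq_tsum => x c; rewrite Bb tsum_lact.
  by rewrite mulr_tsumr; apply: eq_tsum => y d; rewrite mulrA.
by solve_linear.
Qed.

Hypothesis gamma_int : normalised_integral_map psi gamma.

(** This and the next lemma are the two identities of an integral map on pure
tensors, with the associators and tensor products of maps computed away. *)
Lemma psi_gamma c d :
  \tsum_(c1, c2 <- comul c) psi (c1 ⊗ gamma (c2 ⊗ d)) =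
  \tsum_(d1, d2 <- comul d) gamma (c ⊗ d1) ⊗ d2.
Proof.
have gl : linear gamma by exact: linearP.
have idl := @linear_idfun k.
have := gamma_int.1.1 (c ⊗ d).
rewrite !tmap_kpure //; try exact: linearP.
rewrite tassoc_kpure tassocV_kpure !tmap_tsum //.
by rewrite (linear_tsum _ _ psi_linear).
Qed.

Lemma gamma_mulr c d a :
  gamma (c ⊗ d) * a =
  \tsum_(x, d' <- psi (d ⊗ a)) \tsum_(y, c' <- psi (c ⊗ x)) y * gamma (c' ⊗ d').
Proof.
have psil := psi_linear.
have gl : linear gamma by exact: linearP.
have idl := @linear_idfun k.
have cdal : @kbilinear k C A _ (fun x y => c ⊗ x ⊗ y) by solve_linear.
have := gamma_int.1.2 (c ⊗ (d ⊗ a)).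
rewrite tassoc_kpure (tlift_kpure _ _ cdal) !tmap_kpure // tmul_kpure => ->.
rewrite tassoc_kpure tmap_tsum // (linear_tsum _ _ (@tassocV_linear _ A C C)).
rewrite (linear_tsum _ _ (tmap_linear (idl A) gl)).
rewrite (linear_tsum _ _ (@tmul_linear k A)).
apply: eq_tsum => x d'; rewrite tassocV_kpure tmap_tsum //.
exact: tmul_tsum.
Qed.

(** Entwining a factor past gamma and then past the coaction is the action on
a product, because A is an entwined module:
x_(0) a_αβ γ(x_(1)^β ⊗ c^α) = (x a_α)_(0) γ((x a_α)_(1) ⊗ c^α). *)
Lemma expectl_entw_act t a : expectl (entw_act t a) = expectl t * a.
Proof.
rewrite /entw_act (linear_tsum _ _ expectl_linear) mulr_tsuml.
apply: eq_tsum => x c.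
rewrite /expectl tsum_lact ?mulr_tsuml; last exact: expectl_kbilinear.
under [RHS]eq_tsum => y d.
  rewrite -mulrA gamma_mulr mulr_tsumr.
  under eq_tsum => z c' do rewrite mulr_tsumr.
  over.
rewrite exchange_tsum; apply: eq_tsum => z c'.
rewrite -entw_act_rho tsum_tsum; last by solve_linear.
apply: eq_tsum => y d; rewrite tsum_lact; last by solve_linear.
by apply: eq_tsum => w e; rewrite mulrA.
Qed.

(** The tensor a ⊗ b of A ⊗_B A is a ⊗ 1 acted upon by b, and [expectl] is
right A-linear. *)
Lemma expectation_mulr a b : expectation a * b = expectl (lact a (rho b)).
Proof. by rewrite -expectl_entw_act entw_act_lact_rho mul1r. Qed.

(** Right colinearity: the coaction of A ⊗ C is A ⊗ Δ. *)
Lemma rho_expectl t :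
  rho (expectl t) =
  \tsum_(x, c <- t) \tsum_(c1, c2 <- comul c) expectl (x ⊗ c1) ⊗ c2.
Proof.
have psil := psi_linear.
rewrite {1}/expectl (linear_tsum _ _ (linearP rho)); apply: eq_tsum => x c.
rewrite (linear_tsum _ _ (linearP rho)).
under eq_tsum => y d do rewrite -entw_act_rho.
have trP : ktrilinear (fun y e d => lact y (psi (e ⊗ gamma (d ⊗ c)))).
  split=> [d|y e].
    split=> [e|y]; first by solve_linear.
    by apply: linear_fun_app; apply: (linear_fun_comp psil); solve_linear.
  by apply: linear_fun_app; apply: (linear_fun_comp psil); solve_linear.
rewrite (rho_coassoc x rho_comod trP).
under eq_tsum => y d.
  rewrite -(linear_tsum _ _ (lact_linear y)) psi_gamma.
  rewrite (linear_tsum _ _ (lact_linear y)).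
  over.
rewrite exchange_tsum; apply: eq_tsum => c1 c2.
rewrite expectl_kpure (linear_tsum _ _ ((kpure_bilinear A C).1 c2)).
by apply: eq_tsum => y d; rewrite lact_kpure.
Qed.

(** Coassociativity turns the left side into a_(0) γ(a_(1) ⊗ a_(2)), to which
the normalisation of gamma applies. *)
Lemma expectl_rho a : expectl (rho a) = a.
Proof.
have trP : ktrilinear (fun y d c => y * gamma (d ⊗ c)).
  by split=> *; solve_linear.
rewrite /expectl (rho_coassoc a rho_comod trP) -[RHS](rho_comod.2 a).
apply: eq_tsum => x c.
rewrite -mulr_tsumr -(linear_tsum _ _ (linearP gamma)) tsum_kpure.
by rewrite gamma_int.2 -scalerAr mulr1.
Qed.

Lemma conditional_expectation_expectation :
  conditional_expectation (coinv rho) expectation.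
Proof.
split=> [a||b a b' /coinvP Bb Bb'].
- apply/coinvP => b.
  (* With E for the expectation: ρ(E(a) b) = G(a b_(0) ⊗ b_(1)) ⊗ b_(2)
     = E(a) b_(0) ⊗ b_(1), where G is expectl. *)
  rewrite expectation_mulr rho_expectl.
  have trP : ktrilinear (fun x d c => expectl ((a * x) ⊗ d) ⊗ c).
    by split=> *; solve_linear.
  rewrite tsum_lact; last by solve_linear.
  rewrite -(rho_coassoc b rho_comod trP) /lact /tmap.
  apply: eq_tsum => x d; rewrite expectation_mulr.
  rewrite -(linear_tsum _ _ ((kpure_bilinear A C).1 d)).
  rewrite -(linear_tsum _ _ expectl_linear).
  by congr (expectl _ ⊗ _); apply: eq_tsum => y e.
- by rewrite /= /expectation lact1 expectl_rho.
- have EB x : expectation x * b' = expectation (x * b').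
    by rewrite expectation_mulr /expectation lactA -(coinvP _ _ Bb') mulr1.
  by rewrite /= -EB /expectation lactA expectl_lact //; apply/coinvP.
Qed.

Lemma expectl_lact_can u a :
  expectl (lact a (can u)) = \tsum_(x, y <- u) expectation (a * x) * y.
Proof.
rewrite (linear_tsum _ _ (lact_linear a)) (linear_tsum _ _ expectl_linear).
by apply: eq_tsum => x y; rewrite -lactA -expectation_mulr.
Qed.

(** * The conditional expectation on the right factor *)

(** Under can, this is the map x ⊗ y |-> x E(y); see [expectr_rho]. *)
Definition expectr t : A :=
  \tsum_(a, c <- t) \tsum_(x, d <- rho 1)
    \tsum_(y, e <- psi (c ⊗ x)) a * y * gamma (e ⊗ d).

Lemma expectr_kbilinear :
  @kbilinear k A C A (fun a c => \tsum_(x, d <- rho 1)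
    \tsum_(y, e <- psi (c ⊗ x)) a * y * gamma (e ⊗ d)).
Proof.
split=> [c|a]; first by solve_linear.
apply: linear_fun_tsum => x d; apply: linear_fun_tsum_arg.
  by solve_linear.
by apply: (linear_fun_comp psi_linear); solve_linear.
Qed.

Lemma expectr_linear : linear expectr.
Proof. exact: tlift_linear expectr_kbilinear. Qed.

Lemma expectr_lact a t : expectr (lact a t) = a * expectr t.
Proof.
rewrite /expectr tsum_lact; last exact: expectr_kbilinear.
rewrite mulr_tsumr; apply: eq_tsum => b c.
rewrite mulr_tsumr; apply: eq_tsum => x d.
by rewrite mulr_tsumr; apply: eq_tsum => y e; rewrite !mulrA.
Qed.

(** Both sides are (a 1_(0))_(0) γ((a 1_(0))_(1) ⊗ 1_(1)), the left one by
expanding the coaction of the product a 1_(0). *)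
Lemma expectr_rho a : expectr (rho a) = expectation a.
Proof.
rewrite /expectr exchange_tsum /expectation /expectl tsum_lact.
  apply: eq_tsum => x d; rewrite -entw_act_rho tsum_tsum; last by solve_linear.
  by apply: eq_tsum => b c; rewrite tsum_lact; last by solve_linear.
exact: expectl_kbilinear.
Qed.

Lemma expectr_can_bract u a :
  expectr (can (bract u a)) = \tsum_(x, y <- u) x * expectation (y * a).
Proof.
rewrite can_bract_tsum (linear_tsum _ _ expectr_linear).
by apply: eq_tsum => x y; rewrite expectr_lact expectr_rho.
Qed.

End GaloisExtension.

Theorem proposition6p2
  (k : comUnitRingType) (C : coalgType k) (A : algType k)
  (rho : {linear A -> (A ⊗ C)%type})
  (galois : is_coalgebra_galois rho)
  (z : (A ⊗ C)%type) (gamma : {linear (C ⊗ C)%type -> A}) (tau : k)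
  (z_int : normalised_integral (psi_can rho) z)
  (gamma_int : normalised_integral_map (psi_can rho) gamma)
  (tau_unit : tau \is a GRing.unit)
  (cond_i : \tsum_(a, c <- z) \tsum_(x, d <- rho 1)
              \tsum_(y, e <- psi_can rho (c ⊗ x)) a * y * gamma (e ⊗ d)
            = tau *: 1)
  (cond_ii : \tsum_(a, c <- z) \tsum_(x, d <- rho a) x * gamma (d ⊗ c)
             = tau *: 1) :
  strongly_separable_ext (coinv rho).
Proof.
pose u := can_inv rho z.
have can_u : can u = z by exact: can_invK galois.2 z.
have u_sep := can_inv_separability_idempotent galois z_int.
have E_ce := conditional_expectation_expectation galois gamma_int.
split; [by exists u|by exists (expectation rho gamma)|].
exists u, (expectation rho gamma), tau; split=> // a.
- rewrite -(expectl_lact_can galois gamma_int) can_u z_int.1.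
  rewrite -/(entw_act rho z a) (expectl_entw_act galois gamma_int).
  by rewrite [expectl _ _ _]cond_ii -scalerAl mul1r.
- rewrite -(expectr_can_bract galois) -u_sep.1 can_blact can_u.
  by rewrite (expectr_lact galois) [expectr _ _ _]cond_i -scalerAr mulr1.
Qed.
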